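(* Let $i \in \{1,2\}$ and let $G$ be an $i$-MDP with state space $S$. Then $H^{\mathrm{post}} = H^{\mathrm{prio}}$, i.e. for every directed metric $d$ on $S$ and all $s,t \in S$, $$\sup_{x \in \mathcal{D}_i(s)} \inf_{y \in \mathcal{D}_i(t)} \sup_{k \in C(d)} \big(\mathrm{E}^{x}_s(k) - \mathrm{E}^{y}_t(k)\big) = \sup_{k \in C(d)} \sup_{x \in \mathcal{D}_i(s)} \inf_{y \in \mathcal{D}_i(t)} \big(\mathrm{E}^{x}_s(k) - \mathrm{E}^{y}_t(k)\big),$$ and hence $[s \equiv t] \sqcup (\text{left side}) = [s \equiv t] \sqcup (\text{right side})$.
   Context: A game structure $G=(S,[\cdot],\mathit{Moves},\Gamma_1,\Gamma_2,\delta)$ consists of a finite set $S$ of states, a fixed finite set $V$ of observation variables with an interpretation assigning to each $v\in V$ a function $[v]:S\to[0,1]$, a finite set $\mathit{Moves}$, move assignments $\Gamma_1,\Gamma_2: S \to 2^{\mathit{Moves}}\setminus\{\emptyset\}$, and a transition function $\delta: S\times \mathit{Moves}\times\mathit{Moves}\to \mathrm{Distr}(S)$ ($\mathrm{Distr}(A)$ = probability distributions on $A$). For $i\in\{1,2\}$, $G$ is an $i$-MDP if $|\Gamma_{3-i}(s)|=1$ for all $s$; then the single move of player $3-i$ is omitted and one writes $\delta(s,a)$. Mixed moves: $\mathcal{D}_i(s)=\mathrm{Distr}(\Gamma_i(s))$, and $\delta(s,x)(u)=\sum_{a}\delta(s,a)(u)\,x(a)$. A valuation is a function $k:S\to[0,1]$;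 $\mathrm{E}^x_s(k)=\sum_{u\in S}\delta(s,x)(u)\,k(u)$. A directed metric is $d:S\times S\to\mathbb{R}_{\ge 0}$ with $d(s,s)=0$ and $d(s,t)\le d(s,u)+d(u,t)$. $C(d)$ is the set of valuations $k$ with $k(s)-k(t)\le d(s,t)$ for all $s,t$. $[s\equiv t]=\max_{v\in V}|[v](s)-[v](t)|$, and $a\sqcup b=\max\{a,b\}$. *)

(* Defs.v *)
From HB Require Import structures.
From mathcomp Require Import all_boot all_order all_algebra.
From mathcomp Require Import boolp classical_sets reals.

Set Implicit Arguments.
Unset Strict Implicit.
Unset Printing Implicit Defensive.

Import Order.TTheory GRing.Theory Num.Theory.

Local Open Scope classical_set_scope.
Local Open Scope ring_scope.

(* The elements of Distr(A) are represented by functions on the ambient type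
   that vanish outside A. *)
Definition Distr (R : realType) (T : finType) (A : {set T}) : set (T -> R) :=
  [set p | [/\ forall a, 0 <= p a,
               forall a, a \notin A -> p a = 0
             & \sum_(a in A) p a = 1]].

Inductive player := Player1 | Player2.

Definition opponent (i : player) : player :=
  match i with Player1 => Player2 | Player2 => Player1 end.

(* In [trans s a1 a2], a1 is the move of Player1 and a2 that of Player2,
   whichever player is under consideration. *)
Record game_structure (R : realType) (V : finType) := GameStructure {
  state : finType;
  moves : finType;
  obs : V -> state -> R;
  avail : player -> state -> {set moves};
  trans : state -> moves -> moves -> state -> R;
  obs_itv : forall v s, 0 <= obs v s <= 1;
  avail_neq0 : forall i s, avail i s != finset.set0;
  trans_distr : forall s a1 a2, Distr finset.setT (trans s a1 a2)
}.

Arguments obs {R V} g v s.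
Arguments avail {R V} g i s.
Arguments trans {R V} g s a1 a2 u.

Definition is_mdp (R : realType) (V : finType) (G : game_structure R V)
    (i : player) : Prop :=
  forall s : state G, #|avail G (opponent i) s| = 1%N.

(* Some move available to i at s; it is only used for the opponent of the
   MDP player, who has exactly one available move. *)
Definition some_move (R : realType) (V : finType) (G : game_structure R V)
    (i : player) (s : state G) : moves G :=
  xchoose (elimT (set0Pn _) (avail_neq0 i s)).

Definition mdp_trans (R : realType) (V : finType) (G : game_structure R V)
    (i : player) (s : state G) (a : moves G) : state G -> R :=
  match i with
  | Player1 => trans G s a (some_move Player2 s)
  | Player2 => trans G s (some_move Player1 s) a
  end.

Definition mixed_moves (R : realType) (V : finType) (G : game_structure R V)
    (i : player) (s : state G) : set (moves G -> R) :=
  Distr (avail G i s).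

Definition mixed_trans (R : realType) (V : finType) (G : game_structure R V)
    (i : player) (s : state G) (x : moves G -> R) (u : state G) : R :=
  \sum_(a in avail G i s) mdp_trans i s a u * x a.

Definition expect (R : realType) (V : finType) (G : game_structure R V)
    (i : player) (s : state G) (x : moves G -> R) (k : state G -> R) : R :=
  \sum_(u : state G) mixed_trans i s x u * k u.

Definition valuation (R : realType) (S : finType) (k : S -> R) : Prop :=
  forall s, 0 <= k s <= 1.

Record directed_metric (R : realType) (S : finType) (d : S -> S -> R) : Prop :=
  DirectedMetric {
    dmetric_ge0 : forall s t, 0 <= d s t;
    dmetric_refl : forall s, d s s = 0;
    dmetric_triangle : forall s t u, d s t <= d s u + d u t
  }.

Definition C (R : realType) (S : finType) (d : S -> S -> R) : set (S -> R) :=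
  [set k | valuation k /\ forall s t, k s - k t <= d s t].

(* The base value 0 matters only when V is empty. *)
Definition prop_dist (R : realType) (V : finType) (G : game_structure R V)
    (s t : state G) : R :=
  \big[Num.max/0]_(v : V) `|obs G v s - obs G v t|.

(* The real-valued sup and inf are the genuine ones here: every set involved
   is nonempty and contained in [-1, 1]. *)
Definition post_gap (R : realType) (V : finType) (G : game_structure R V)
    (i : player) (d : state G -> state G -> R) (s t : state G) : R :=
  sup [set inf [set sup [set expect i s x k - expect i t y k | k in C d]
                   | y in mixed_moves i t]
          | x in mixed_moves i s].

Definition prio_gap (R : realType) (V : finType) (G : game_structure R V)
    (i : player) (d : state G -> state G -> R) (s t : state G) : R :=
  sup [set sup [set inf [set expect i s x k - expect i t y k
                            | y in mixed_moves i t]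
                   | x in mixed_moves i s]
          | k in C d].

Definition H_post (R : realType) (V : finType) (G : game_structure R V)
    (i : player) (d : state G -> state G -> R) (s t : state G) : R :=
  Num.max (prop_dist s t) (post_gap i d s t).

Definition H_prio (R : realType) (V : finType) (G : game_structure R V)
    (i : player) (d : state G -> state G -> R) (s t : state G) : R :=
  Num.max (prop_dist s t) (prio_gap i d s t).

(* Main.v *)
(** For a fixed mixed move [x] of [s] the payoff is affine in [k], which ranges
over a convex set, and affine in [y], which ranges over the simplex spanned by
finitely many pure moves.  Hence [inf_y] and [sup_k] commute by Ky Fan's
minimax theorem, after which [sup_x] and [sup_k] commute trivially.  The minimax
theorem follows from a theorem of the alternative: finitely many concave
functions without a common point of positivity have a convex combination that
is nowhere positive.  This goes by induction on the number of functions,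
restricting to the (convex) set where the first one is positive; two functions
are handled by a direct choice of the weight as a supremum of slopes, so
neither compactness nor a separation theorem is needed. *)

Require Import Defs.
From HB Require Import structures.
From mathcomp Require Import all_boot all_order all_algebra.
From mathcomp Require Import boolp classical_sets reals.
From mathcomp Require Import ring lra.

Set Implicit Arguments.
Unset Strict Implicit.
Unset Printing Implicit Defensive.

Import Order.TTheory GRing.Theory Num.Theory.

Local Open Scope classical_set_scope.
Local Open Scope ring_scope.

(** * A theorem of the alternative for concave-like families *)

(** This is Fan's form of concavity: one dominating point [k] serves all indices at once, so [K]
    carries no linear structure. *)
Definition concave_like (R : realType) (K I : Type) (C : set K)
    (f : I -> K -> R) : Prop :=
  forall k1 k2 (t : R), C k1 -> C k2 -> 0 <= t -> t <= 1 ->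
  exists2 k, C k & forall i, t * f i k1 + (1 - t) * f i k2 <= f i k.

(** Where the first function [g] is nonpositive and the second, [f], is positive, the conclusion
    says [l >= f / (f - g)]; where the signs are exchanged it says [l <= - f / (g - f)]. The
    supremum of the lower bounds is a valid weight once each of them is below each upper bound. *)
Lemma concave_like_pair_alternative (R : realType) (K : Type) (C : set K)
    (h : bool -> K -> R) :
  concave_like C h ->
  (forall k, C k -> ~ (0 < h true k /\ 0 < h false k)) ->
  exists l : R, [/\ 0 <= l, l <= 1 &
    forall k, C k -> l * h true k + (1 - l) * h false k <= 0].
Proof.
set g := h true; set f := h false => hC disj.
(* This is lower bound at [k1] below upper bound at [k2], with denominators cleared. If it failed, a
   mixture of [k1] and [k2] would be dominated by a point where both functions are positive. *)
have cross k1 k2 : C k1 -> C k2 -> 0 < f k1 -> 0 < g k2 ->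
    f k1 * g k2 <= f k2 * g k1.
  move=> C1 C2 f1 g2; rewrite leNgt; apply/negP => lt12.
  have g1 : g k1 <= 0.
    by rewrite leNgt; apply/negP => g1; apply: (disj k1 C1).
  have f2 : f k2 <= 0.
    by rewrite leNgt; apply/negP => f2; apply: (disj k2 C2).
  (* The weights a, b make both a f1 + b f2 and a g1 + b g2 equal to
     f1 g2 - f2 g1. *)
  set a := g k2 - f k2; set b := f k1 - g k1.
  have a0 : 0 < a by rewrite /a; lra.
  have b0 : 0 < b by rewrite /b; lra.
  have ab0 : 0 < a + b by lra.
  have abE : 1 - a / (a + b) = b / (a + b) by field; lra.
  have t0 : 0 <= a / (a + b) by rewrite divr_ge0 // ltW.
  have t1 : a / (a + b) <= 1 by rewrite ler_pdivrMr //; lra.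
  have [k Ck hk] := hC k1 k2 _ C1 C2 t0 t1.
  have pos : 0 < (f k1 * g k2 - f k2 * g k1) / (a + b).
    by rewrite divr_gt0 // subr_gt0.
  apply: (disj k Ck); split.
    apply: lt_le_trans pos (le_trans _ (hk true)).
    by rewrite abE -/g le_eqVlt; apply/orP; left; apply/eqP; rewrite /a /b; field; lra.
  apply: lt_le_trans pos (le_trans _ (hk false)).
  by rewrite abE -/f le_eqVlt; apply/orP; left; apply/eqP; rewrite /a /b; field; lra.
(* The element 0 keeps [E] nonempty when [f] is nowhere positive, and yields [0 <= sup E]. *)
pose E := [set r : R | r = 0 \/
  exists k, [/\ C k, 0 < f k & r = f k / (f k - g k)]].
have E0 : E !=set0 by exists 0; left.
have g_le0 k : C k -> 0 < f k -> g k <= 0.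
  by move=> Ck fk; rewrite leNgt; apply/negP => gk; apply: (disj k Ck).
have E1 : ubound E 1.
  move=> r [->|[k [Ck fk ->]]]; first exact: ler01.
  have gk := g_le0 k Ck fk.
  by rewrite ler_pdivrMr; lra.
have supE : has_sup E by split=> //; exists 1.
exists (sup E); split.
- by apply: ub_le_sup; [exact: supE.2 | left].
- exact: ge_sup.
move=> k Ck.
have l0 : 0 <= sup E by apply: ub_le_sup; [exact: supE.2 | left].
have l1 : sup E <= 1 by exact: ge_sup.
have [fk|fk] := ltP 0 (f k).
  have gk := g_le0 k Ck fk.
  have : f k / (f k - g k) <= sup E.
    by apply: ub_le_sup; [exact: supE.2 | right; exists k].
  by rewrite ler_pdivrMr; lra.
have [gk|gk] := ltP 0 (g k); last by nra.
suff : sup E <= (- f k) / (g k - f k).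
  by rewrite ler_pdivlMr; lra.
apply: ge_sup => // r [->|[k1 [C1 f1 ->]]].
  by apply: divr_ge0; lra.
have g1 := g_le0 k1 C1 f1.
have := cross k1 k C1 Ck f1 gk.
have d1 : 0 < f k1 - g k1 by lra.
have d2 : 0 < g k - f k by lra.
by rewrite ler_pdivrMr // mulrAC ler_pdivlMr //; lra.
Qed.

(** The induction on [r] keeps [C] general, because the hypothesis is applied to the part of [C]
    where the head function is positive. *)
Lemma concave_like_alternative (R : realType) (K : Type) (T : eqType)
    (r : seq T) (C : set K) (f : T -> K -> R) :
  uniq r -> C !=set0 -> concave_like C f ->
  (forall k, C k -> ~ (forall a, a \in r -> 0 < f a k)) ->
  exists y : T -> R, [/\ forall a, 0 <= y a,
    forall a, a \notin r -> y a = 0,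
    \sum_(a <- r) y a = 1 &
    forall k, C k -> \sum_(a <- r) y a * f a k <= 0].
Proof.
elim: r C => [|b r IHr] C /=; first by move=> _ [k Ck] _ /(_ k Ck) [].
move=> /andP[br ur] C0 cf disj.
(* As [b] is not in [r], the weight given to [b] does not affect sums over [r]. *)
have sumb (z : T -> R) (c : R) (F : T -> R -> R) :
    \sum_(a <- r) F a (if a == b then c else z a) = \sum_(a <- r) F a (z a).
  by apply: eq_big_seq => a ar; case: eqP => // ab; rewrite -ab ar in br.
pose C' := [set k | C k /\ 0 < f b k].
(* If [C'] is empty, [f b] is nonpositive on [C] and the point mass at [b] works. *)
have [C'0|C'0] := pselect (C' !=set0); last first.
  exists (fun a => if a == b then 1 else 0); split.
  - by move=> a; case: ifP.
  - by move=> a; rewrite inE; case: eqP.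
  - by rewrite big_cons eqxx (sumb (fun=> 0) 1 (fun=> id)) big1 ?addr0.
  - move=> k Ck; rewrite big_cons eqxx mul1r.
    rewrite (sumb (fun=> 0) 1 (fun a v => v * f a k)) big1 ?addr0.
      by rewrite leNgt; apply/negP => fk; apply: C'0; exists k.
    by move=> a; rewrite mul0r.
have cf' : concave_like C' f.
  move=> k1 k2 t [C1 f1] [C2 f2] t0 t1.
  have [k Ck hk] := cf k1 k2 t C1 C2 t0 t1.
  exists k => //; split=> //; apply: lt_le_trans (hk b).
  by nra.
have [k [Ck fk] all_pos|y [y0 yr y1 yle]] := IHr C' ur C'0 cf'.
  apply: (disj k Ck) => a; rewrite inE => /orP[/eqP->//|]; exact: all_pos.
(* The combination [g] is nonpositive wherever [f b] is positive, so the two-function case applies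
   to [g] and [f b] on all of [C]. *)
pose g k := \sum_(a <- r) y a * f a k.
have cgf : concave_like C (fun c : bool => if c then g else f b).
  move=> k1 k2 t C1 C2 t0 t1; have [k Ck hk] := cf k1 k2 t C1 C2 t0 t1.
  exists k => // -[] //; rewrite /g !mulr_sumr -big_split /=.
  apply: ler_sum => a _; have := ler_wpM2l (y0 a) (hk a).
  by apply: le_trans; rewrite le_eqVlt; apply/orP; left; apply/eqP; ring.
have [k Ck [gk fk]|l [l0 l1 hl]] := concave_like_pair_alternative cgf.
  by have := yle k (conj Ck fk); rewrite leNgt gk.
exists (fun a => if a == b then 1 - l else l * y a); split.
- by move=> a; case: ifP => _; [rewrite subr_ge0 | rewrite mulr_ge0].
- move=> a; rewrite inE negb_or => /andP[/negPf-> ar]; by rewrite yr ?mulr0.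
- rewrite big_cons eqxx (sumb (fun a => l * y a) (1 - l) (fun=> id)).
  by rewrite -mulr_sumr y1 mulr1 subrK.
- move=> k Ck; rewrite big_cons eqxx.
  rewrite (sumb (fun a => l * y a) (1 - l) (fun a v => v * f a k)).
  under eq_bigr do rewrite -mulrA.
  rewrite -mulr_sumr addrC; exact: hl.
Qed.

(** * Averages under a distribution *)

Lemma Distr_neq0 (R : realType) (T : finType) (A : {set T}) :
  A != finset.set0 -> @Distr R T A !=set0.
Proof.
move=> /set0Pn[a aA]; exists (fun b => (b == a)%:R); split.
- by move=> b; rewrite ler0n.
- by move=> b bA; case: eqP => // ba; rewrite ba aA in bA.
- rewrite (bigD1 a) //= eqxx big1 ?addr0 // => b /andP[_ /negPf->] //.
Qed.

Lemma Distr_avg_le (R : realType) (T : finType) (A : {set T}) (p F : T -> R)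
    (M : R) :
  Distr A p -> (forall a, a \in A -> F a <= M) -> \sum_(a in A) p a * F a <= M.
Proof.
move=> [p0 _ p1] FM; rewrite -[M]mul1r -p1 mulr_suml.
by apply: ler_sum => a aA; apply: ler_wpM2l => //; apply: FM.
Qed.

Lemma Distr_avg_ge (R : realType) (T : finType) (A : {set T}) (p F : T -> R)
    (m : R) :
  Distr A p -> (forall a, a \in A -> m <= F a) -> m <= \sum_(a in A) p a * F a.
Proof.
move=> [p0 _ p1] Fm; rewrite -[m]mul1r -p1 mulr_suml.
by apply: ler_sum => a aA; apply: ler_wpM2l => //; apply: Fm.
Qed.

(** * Suprema and infima of bounded images *)

Section BoundedImages.
Variables (R : realType) (X : Type) (A : set X) (m M : R).
Hypothesis A0 : A !=set0.

Lemma le_sup_image (F : X -> R) (x : X) :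
  (forall x, A x -> F x <= M) -> A x -> F x <= sup [set F x | x in A].
Proof.
by move=> FM Ax; apply: ub_le_sup; [exists M => _ [z Az <-]; exact: FM | exists x].
Qed.

Lemma ge_inf_image (F : X -> R) (x : X) :
  (forall x, A x -> m <= F x) -> A x -> inf [set F x | x in A] <= F x.
Proof.
by move=> Fm Ax; apply: ge_inf; [exists m => _ [z Az <-]; exact: Fm | exists x].
Qed.

Lemma sup_image_le (F : X -> R) (c : R) :
  (forall x, A x -> F x <= c) -> sup [set F x | x in A] <= c.
Proof.
move=> Fc; apply: ge_sup; last by move=> _ [x Ax <-]; exact: Fc.
by have [x Ax] := A0; exists (F x); exists x.
Qed.

Lemma inf_image_ge (F : X -> R) (c : R) :
  (forall x, A x -> c <= F x) -> c <= inf [set F x | x in A].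
Proof.
move=> Fc; apply: lb_le_inf; last by move=> _ [x Ax <-]; exact: Fc.
by have [x Ax] := A0; exists (F x); exists x.
Qed.

End BoundedImages.

(** The uniform bound [M] also bounds the inner suprema, so that the outer ones are genuine. *)
Lemma sup_image_comm (R : realType) (X Y : Type) (A : set X) (B : set Y)
    (F : X -> Y -> R) (M : R) :
  A !=set0 -> B !=set0 -> (forall x y, A x -> B y -> F x y <= M) ->
  sup [set sup [set F x y | y in B] | x in A] =
  sup [set sup [set F x y | x in A] | y in B].
Proof.
move=> A0 B0 FM; apply/eqP; rewrite eq_le; apply/andP; split.
  apply: sup_image_le => // x Ax; apply: sup_image_le => // y By.
  apply: le_trans (le_sup_image (F := fun y => sup [set F x y | x in A])
    (M := M) _ By) => [|z Bz].
    by apply: (le_sup_image (F := F^~ y) (M := M)) => // z Az; exact: FM.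
  by apply: sup_image_le => // z' Az'; exact: FM.
apply: sup_image_le => // y By; apply: sup_image_le => // x Ax.
apply: le_trans (le_sup_image (F := fun x => sup [set F x y | y in B])
  (M := M) _ Ax) => [|z Az].
  by apply: (le_sup_image (F := F x) (M := M)) => // z Bz; exact: FM.
by apply: sup_image_le => // z' Bz'; exact: FM.
Qed.

(** * Minimax over a simplex *)

Theorem minimax_simplex (R : realType) (K : Type) (T : finType) (A : {set T})
    (C : set K) (f : T -> K -> R) (m M : R) :
  A != finset.set0 -> C !=set0 -> concave_like C f ->
  (forall a k, C k -> m <= f a k <= M) ->
  inf [set sup [set \sum_(a in A) y a * f a k | k in C] | y in Distr A] =
  sup [set inf [set \sum_(a in A) y a * f a k | y in Distr A] | k in C].
Proof.
move=> An0 C0 cf fmM.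
have D0 := Distr_neq0 R An0.
pose F y k := \sum_(a in A) y a * f a k.
have Fm y k : Distr A y -> C k -> m <= F y k.
  by move=> Dy Ck; apply: Distr_avg_ge => // a _; case/andP: (fmM a k Ck).
have FM y k : Distr A y -> C k -> F y k <= M.
  by move=> Dy Ck; apply: Distr_avg_le => // a _; case/andP: (fmM a k Ck).
have FMs y k : Distr A y -> C k -> F y k <= sup [set F y k | k in C].
  by move=> Dy; apply: le_sup_image => k' Ck'; apply: (FM y k').
have Fmi y k : Distr A y -> C k -> inf [set F y k | y in Distr A] <= F y k.
  move=> Dy Ck; apply: (ge_inf_image (F := F^~ k) (m := m)) => // y' Dy'.
  exact: Fm.
(* The easy inequality, sup inf below inf sup, comes first. *)
apply/eqP; rewrite eq_le; apply/andP; split; last first.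
  apply: sup_image_le => // k Ck; apply: inf_image_ge => // y Dy.
  exact: le_trans (Fmi y k Dy Ck) (FMs y k Dy Ck).
set w := sup _.
have le_w k : C k -> inf [set F y k | y in Distr A] <= w.
  apply: (le_sup_image (F := fun k => inf [set F y k | y in Distr A])
    (M := M)) => k' Ck'.
  have [y Dy] := D0; exact: le_trans (Fmi y k' Dy Ck') (FM y k' Dy Ck').
have cfw : concave_like C (fun a k => f a k - w).
  move=> k1 k2 t C1 C2 t0 t1; have [k Ck hk] := cf k1 k2 t C1 C2 t0 t1.
  by exists k => // a; have := hk a; lra.
(* A pure move [a] minimizing [f a k] is a lower bound for all averages, hence [f a k] is at most
   the infimum over [y], and so at most [w]. *)
have disj k : C k -> ~ (forall a, a \in enum A -> 0 < f a k - w).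
  move=> Ck pos; have /set0Pn[a0 a0A] := An0.
  have [a aA amin] := @arg_minP _ _ _ a0 (mem A) (f^~ k) a0A.
  have : f a k <= w.
    apply: le_trans (le_w k Ck); apply: inf_image_ge => // y Dy.
    exact: Distr_avg_ge.
  by have := pos a; rewrite mem_enum -subr_gt0 => /(_ aA); lra.
have [y [y0 yA y1 yle]] :=
  concave_like_alternative (enum_uniq A) C0 cfw disj.
have Dy : Distr A y.
  by split=> // [a aA|]; [apply: yA; rewrite mem_enum | rewrite -big_enum].
(* The [y] just obtained keeps the payoff at most [w] for every [k], so it witnesses the hard
   inequality. *)
apply: le_trans (_ : sup [set F y k | k in C] <= w).
  apply: (ge_inf_image (F := fun y => sup [set F y k | k in C])
    (m := m)) => // y' Dy'.
  have [k Ck] := C0; exact: le_trans (Fm y' k Dy' Ck) (FMs y' k Dy' Ck).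
apply: sup_image_le => // k Ck; have := yle k Ck; rewrite big_enum /=.
under eq_bigr do rewrite mulrBr.
by case: Dy => _ _ Dy1; rewrite big_split /= sumrN -mulr_suml Dy1 mul1r subr_le0.
Qed.

(** * Expectations in an MDP *)

Section MDP.
Variables (R : realType) (V : finType) (G : game_structure R V) (i : player).

Lemma mdp_trans_distr (s : state G) (a : moves G) :
  Distr finset.setT (mdp_trans i s a).
Proof. by case: i; apply: trans_distr. Qed.

Definition pure_expect (s : state G) (a : moves G) (k : state G -> R) : R :=
  \sum_(u : state G) mdp_trans i s a u * k u.

(** Exchanging the two sums exhibits the average over pure moves that [minimax_simplex] works
    with. *)
Lemma expectE (s : state G) (x : moves G -> R) (k : state G -> R) :
  expect i s x k = \sum_(a in avail G i s) x a * pure_expect s a k.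
Proof.
rewrite /expect /mixed_trans; under eq_bigr do rewrite mulr_suml.
rewrite exchange_big /=; apply: eq_bigr => a _.
by rewrite mulr_sumr; apply: eq_bigr => u _; rewrite mulrAC mulrC mulrA.
Qed.

Lemma pure_expect_itv (s : state G) (a : moves G) (k : state G -> R) :
  valuation k -> 0 <= pure_expect s a k <= 1.
Proof.
move=> kv; have D := mdp_trans_distr s a.
have -> : pure_expect s a k = \sum_(u in finset.setT) mdp_trans i s a u * k u.
  by apply: eq_bigl => u; rewrite inE.
by rewrite Distr_avg_ge ?Distr_avg_le // => u _; have /andP[] := kv u.
Qed.

Lemma expect_itv (s : state G) (x : moves G -> R) (k : state G -> R) :
  mixed_moves i s x -> valuation k -> 0 <= expect i s x k <= 1.
Proof.
move=> Dx kv; rewrite expectE.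
by rewrite Distr_avg_ge ?Distr_avg_le // => a _;
  have /andP[] := pure_expect_itv s a kv.
Qed.

Lemma pure_expect_affine (s : state G) (a : moves G) (k1 k2 : state G -> R)
    (p q : R) :
  pure_expect s a (fun u => p * k1 u + q * k2 u) =
  p * pure_expect s a k1 + q * pure_expect s a k2.
Proof.
rewrite /pure_expect !mulr_sumr -big_split /=.
by apply: eq_bigr => u _; ring.
Qed.

Lemma expect_affine (s : state G) (x : moves G -> R) (k1 k2 : state G -> R)
    (p q : R) :
  expect i s x (fun u => p * k1 u + q * k2 u) =
  p * expect i s x k1 + q * expect i s x k2.
Proof.
rewrite /expect !mulr_sumr -big_split /=.
by apply: eq_bigr => u _; ring.
Qed.

End MDP.

(** * The convex set of valuations bounded by a directed metric *)

Lemma C_neq0 (R : realType) (S : finType) (d : S -> S -> R) :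
  directed_metric d -> C d !=set0.
Proof.
move=> [d0 _ _]; exists (fun=> 0); split=> [s|s t]; first by rewrite lexx ler01.
by rewrite subr0.
Qed.

Lemma C_convex (R : realType) (S : finType) (d : S -> S -> R)
    (k1 k2 : S -> R) (t : R) :
  C d k1 -> C d k2 -> 0 <= t -> t <= 1 ->
  C d (fun u => t * k1 u + (1 - t) * k2 u).
Proof.
move=> [v1 h1] [v2 h2] t0 t1; split=> [u|u v].
  have /andP[? ?] := v1 u; have /andP[? ?] := v2 u.
  by apply/andP; split; nra.
by have := h1 u v; have := h2 u v; nra.
Qed.

(** * Equality of the two gaps *)

Lemma post_gap_eq_prio_gap (R : realType) (V : finType)
    (G : game_structure R V) (i : player) (d : state G -> state G -> R)
    (s t : state G) :
  directed_metric d -> post_gap i d s t = prio_gap i d s t.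
Proof.
move=> dd; rewrite /post_gap /prio_gap.
have C0 := C_neq0 dd.
have Ds0 : mixed_moves i s !=set0 := Distr_neq0 R (avail_neq0 i s).
have Dt0 : mixed_moves i t !=set0 := Distr_neq0 R (avail_neq0 i t).
(* The weights of [y] sum to 1, so the term in [x] can be moved under the average. *)
have gapE x k y : mixed_moves i t y -> expect i s x k - expect i t y k =
    \sum_(b in avail G i t) y b * (expect i s x k - pure_expect i t b k).
  move=> [_ _ y1]; under eq_bigr do rewrite mulrBr.
  by rewrite big_split /= sumrN -mulr_suml y1 mul1r -expectE.
have gap_itv x y k : mixed_moves i s x -> mixed_moves i t y -> C d k ->
    -1 <= expect i s x k - expect i t y k <= 1.
  move=> Dx Dy [kv _]; have := expect_itv Dx kv; have := expect_itv Dy kv.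
  by move=> /andP[? ?] /andP[? ?]; apply/andP; split; lra.
have minimax x : mixed_moves i s x ->
    inf [set sup [set expect i s x k - expect i t y k | k in C d]
        | y in mixed_moves i t] =
    sup [set inf [set expect i s x k - expect i t y k | y in mixed_moves i t]
        | k in C d].
  move=> Dx.
  transitivity (inf [set sup [set \sum_(b in avail G i t)
      y b * (expect i s x k - pure_expect i t b k) | k in C d]
      | y in mixed_moves i t]).
    congr inf; apply: eq_imagel => y Dy; congr sup.
    by apply: eq_imagel => k _; exact: gapE.
  rewrite (@minimax_simplex _ _ _ _ _
    (fun b k => expect i s x k - pure_expect i t b k) (-1) 1) //.
  - congr sup; apply: eq_imagel => k _; congr inf.
    by apply: eq_imagel => y Dy; rewrite gapE.
  - exact: avail_neq0.
  (* The payoff is affine in [k], so the convex combination itself is the dominating point, with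
     equality. *)
  - move=> k1 k2 p C1 C2 p0 p1.
    exists (fun u => p * k1 u + (1 - p) * k2 u); first exact: C_convex.
    by move=> b; rewrite expect_affine pure_expect_affine; lra.
  - move=> b k [kv _]; have /andP[? ?] := expect_itv Dx kv.
    have /andP[? ?] := pure_expect_itv i t b kv.
    by apply/andP; split; lra.
transitivity (sup [set sup [set inf [set expect i s x k - expect i t y k
    | y in mixed_moves i t] | k in C d] | x in mixed_moves i s]).
  by congr sup; apply: eq_imagel => x Dx; exact: minimax.
apply: (sup_image_comm (M := 1)) => // x k Dx Ck.
(* Any single [y] bounds the infimum from above by 1. *)
have [y Dy] := Dt0; have /andP[_] := gap_itv x y k Dx Dy Ck.
apply: le_trans.
apply: (ge_inf_image (F := fun y => expect i s x k - expect i t y k)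
  (m := -1)) => // y' Dy'.
by have /andP[] := gap_itv x y' k Dx Dy' Ck.
Qed.

Theorem theorem3p1 (R : realType) (V : finType) (i : player)
    (G : game_structure R V) (G_mdp : is_mdp G i) :
  forall d : state G -> state G -> R, directed_metric d ->
  forall s t : state G,
    sup [set inf [set sup [set expect i s x k - expect i t y k | k in C d]
                     | y in mixed_moves i t]
            | x in mixed_moves i s]
    = sup [set sup [set inf [set expect i s x k - expect i t y k
                                | y in mixed_moves i t]
                       | x in mixed_moves i s]
              | k in C d]
    /\ H_post i d s t = H_prio i d s t.
Proof.
move=> d dd s t; have gapE := post_gap_eq_prio_gap i s t dd.
by split; [exact: gapE | rewrite /H_post /H_prio gapE].
Qed.
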